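(* Let $G$ be a group and $\Bbbk$ a field. (I) Let $B\colon G\to G$ be a GA--RB--operator on $G$, and put $H=\operatorname{Im}B=B(G)$ and $K=\ker B=\{g\in G: B(g)=1\}$ (these are subgroups of $G$). Then: 1. $G=KH$ is an exact factorization; 2. $B(kh)=h$ for all $k\in K$, $h\in H$; 3. $H$ is commutative and $h^2Kh^{-2}\subset K$ for all $h\in H$. (II) Conversely, for any exact group factorization $G=KH$ such that $H$ is commutative and $h^2Kh^{-2}\subset K$ for all $h\in H$, the operator $B\colon G\to G$, $B(kh)=h$ ($k\in K$, $h\in H$), is a GA--RB--operator on $G$.
   Context: A group Rota--Baxter operator (of weight 1) on a group $G$ is a map $B\colon G\to G$ such that $B(g)B(h)=B(gB(g)hB(g)^{-1})$ for all $g,h\in G$. A group Rota--Baxter operator $B$ on $G$ is called a group-algebra Rota--Baxter operator (GA--RB--operator) of weight $\lambda\in\Bbbk$ if its linear extension to the group algebra $\Bbbk[G]$ is an algebra Rota--Baxter operator of weight $\lambda$, i.e. $B(g)B(h)=B(B(g)h+gB(h)+\lambda gh)$ in $\Bbbk[G]$ for all $g,h\in G$. It is called a GA--RB--operator if it is one of some weight $\lambda\in\Bbbk$. An exact factorization $G=KH$ means that $K$ and $H$ are subgroups of $G$ with $G=KH$ and $K\cap H=\{1\}$ (so every element of $G$ is uniquely of the form $kh$ with $k\in K$, $h\in H$). *)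

(* Defs.v *)
From HB Require Import structures.
From mathcomp Require Import all_boot all_algebra.
From mathcomp Require Import finmap monalg.
From mathcomp Require Import boolp classical_sets.

Set Implicit Arguments.
Unset Strict Implicit.
Unset Printing Implicit Defensive.

Import GRing.Theory.
Local Open Scope ring_scope.

(* The unique linear map k[X] -> V sending the basis vector << g >> to F g.   *)
Section LinearExtension.
Context (k : fieldType) (X : choiceType) (V : lmodType k).

Definition lin_ext (F : X -> V) (x : {malg k[X]}) : V :=
  \sum_(g <- msupp x) x@_g *: F g.

Lemma lin_extEw (F : X -> V) (d : {fset X}) x :
  (msupp x `<=` d)%fset -> lin_ext F x = \sum_(g <- d) x@_g *: F g.
Proof.
move=> le; rewrite /lin_ext [LHS](big_fset_incl _ le) //= => g gd.
by move=> /mcoeff_outdom ->; rewrite scale0r.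
Qed.

Lemma lin_ext_is_linear (F : X -> V) : linear (lin_ext F).
Proof.
move=> c x y; set d := (msupp x `|` msupp y)%fset.
have dx : (msupp x `<=` d)%fset by apply: fsubsetUl.
have dy : (msupp y `<=` d)%fset by apply: fsubsetUr.
have dxy : (msupp (c *: x + y) `<=` d)%fset.
  apply: fsubset_trans (msuppD_le _ _) _.
  by apply: fsetUSS => //; apply: msuppZ_le.
rewrite (lin_extEw F dx) (lin_extEw F dy) (lin_extEw F dxy).
rewrite scaler_sumr -big_split /=; apply: eq_bigr => g _.
by rewrite mcoeffD mcoeffZ scalerDl scalerA.
Qed.

HB.instance Definition _ (F : X -> V) :=
  GRing.isLinear.Build k {malg k[X]} V *:%R (lin_ext F) (lin_ext_is_linear F).

Lemma lin_extU (F : X -> V) g : lin_ext F << g >> = F g.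
Proof. by rewrite (lin_extEw F msuppU_le) big_seq_fset1 mcoeffUU scale1r. Qed.

Lemma malg_basisE (x : {malg k[X]}) : x = \sum_(g <- msupp x) x@_g *: << g >>.
Proof.
rewrite [LHS]monalgE; apply: eq_bigr => g _.
by apply/malgP => h; rewrite mcoeffZ !mcoeffU mulrnAr mulr1.
Qed.

Lemma eq_lin_basis (f1 f2 : {linear {malg k[X]} -> V}) :
  (forall g, f1 << g >> = f2 << g >>) -> f1 =1 f2.
Proof.
move=> ef x; rewrite [x]malg_basisE !linear_sum; apply: eq_bigr => g _.
by rewrite !linearZ /= ef.
Qed.

End LinearExtension.

(* monalg only puts a ring structure on {malg k[X]} when X is a monomType,    *)
(* which excludes nontrivial groups; hence this copy with its own product.    *)
Definition group_algebra (k : fieldType) (G : groupType) : Type := {malg k[G]}.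

Section GroupAlgebra.
Context (k : fieldType) (G : groupType).

HB.instance Definition _ := GRing.Lmodule.on (group_algebra k G).

Local Notation kG := (group_algebra k G).

Definition ga_basis (g : G) : kG := << g >>.

Definition ga_mul (x y : kG) : kG :=
  lin_ext (fun g => lin_ext (fun h => ga_basis (g * h)%g) y) x.

Lemma ga_basisE (x : kG) : x = \sum_(g <- msupp x) x@_g *: ga_basis g.
Proof. exact: malg_basisE. Qed.

Lemma ga_mul_linl (y : kG) : linear (ga_mul^~ y).
Proof. by move=> c x1 x2; rewrite /ga_mul linearP. Qed.

Lemma ga_mul_linr (x : kG) : linear (ga_mul x).
Proof.
move=> c y1 y2; rewrite /ga_mul /lin_ext scaler_sumr -big_split /=.
apply: eq_bigr => g _; rewrite -/(lin_ext _ _) -/(lin_ext _ y1).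
by rewrite -/(lin_ext _ y2) linearP scalerDr !scalerA mulrC.
Qed.

Lemma ga_mulU (g h : G) : ga_mul (ga_basis g) (ga_basis h) = ga_basis (g * h)%g.
Proof. by rewrite /ga_mul !lin_extU. Qed.

Lemma ga_ind (f1 f2 : kG -> kG) : linear f1 -> linear f2 ->
  (forall g, f1 (ga_basis g) = f2 (ga_basis g)) -> f1 =1 f2.
Proof.
move=> l1 l2 ef.
pose F1 := GRing.isLinear.Build k kG kG *:%R f1 l1.
pose F2 := GRing.isLinear.Build k kG kG *:%R f2 l2.
pose L1 : {linear kG -> kG} := HB.pack f1 F1.
pose L2 : {linear kG -> kG} := HB.pack f2 F2.
exact: (@eq_lin_basis k G kG L1 L2 ef).
Qed.

Lemma ga_mulA : associative ga_mul.
Proof.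
move=> x y z; move: x.
apply: (@ga_ind (ga_mul^~ (ga_mul y z)) (fun x => ga_mul (ga_mul x y) z)).
- exact: ga_mul_linl.
- by move=> c a b; rewrite !ga_mul_linl.
move=> g; move: y.
apply: (@ga_ind (fun y => ga_mul (ga_basis g) (ga_mul y z))
                (fun y => ga_mul (ga_mul (ga_basis g) y) z)).
- by move=> c a b; rewrite ga_mul_linl ga_mul_linr.
- by move=> c a b; rewrite ga_mul_linr ga_mul_linl.
move=> h; move: z.
apply: (@ga_ind (fun z => ga_mul (ga_basis g) (ga_mul (ga_basis h) z))
                (ga_mul (ga_mul (ga_basis g) (ga_basis h)))).
- by move=> c a b; rewrite !ga_mul_linr.
- exact: ga_mul_linr.
by move=> l; rewrite !ga_mulU mulgA.
Qed.

Lemma ga_mul1l : left_id (ga_basis 1%g) ga_mul.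
Proof.
apply: ga_ind => [c a b|//|g]; first by rewrite ga_mul_linr.
by rewrite ga_mulU mul1g.
Qed.

Lemma ga_mul1r : right_id (ga_basis 1%g) ga_mul.
Proof.
apply: ga_ind => [c a b|//|g]; first by rewrite ga_mul_linl.
by rewrite ga_mulU mulg1.
Qed.

Lemma ga_mulDl : left_distributive ga_mul +%R.
Proof. by move=> x y z; have := ga_mul_linl z 1 x y; rewrite !scale1r. Qed.

Lemma ga_mulDr : right_distributive ga_mul +%R.
Proof. by move=> x y z; have := ga_mul_linr x 1 y z; rewrite !scale1r. Qed.

Lemma ga_one_neq0 : ga_basis 1%g != 0.
Proof. by rewrite monalgU_eq0 oner_neq0. Qed.

HB.instance Definition _ := GRing.Zmodule_isNzRing.Build kG
  ga_mulA ga_mul1l ga_mul1r ga_mulDl ga_mulDr ga_one_neq0.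

Lemma ga_scaleAl (c : k) (x y : kG) : c *: (x * y) = (c *: x) * y.
Proof.
have: (c *: x + 0) * y = c *: (x * y) + 0 * y := ga_mul_linl y c x 0.
by rewrite mul0r !addr0.
Qed.

Lemma ga_scaleAr (c : k) (x y : kG) : c *: (x * y) = x * (c *: y).
Proof.
have: x * (c *: y + 0) = c *: (x * y) + x * 0 := ga_mul_linr x c y 0.
by rewrite mulr0 !addr0.
Qed.

HB.instance Definition _ := GRing.Lmodule_isLalgebra.Build k kG ga_scaleAl.
HB.instance Definition _ := GRing.Lalgebra_isAlgebra.Build k kG ga_scaleAr.

Definition ga_ext (B : G -> G) (x : kG) : kG := lin_ext (fun g => ga_basis (B g)) x.

HB.instance Definition _ (B : G -> G) := GRing.isLinear.Build k kG kG *:%R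
  (ga_ext B) (@lin_ext_is_linear k G kG (fun g => ga_basis (B g))).

Lemma ga_extU (B : G -> G) g : ga_ext B (ga_basis g) = ga_basis (B g).
Proof. exact: lin_extU. Qed.

Lemma ga_basisM (g h : G) : ga_basis g * ga_basis h = ga_basis (g * h)%g.
Proof. exact: ga_mulU. Qed.

End GroupAlgebra.

Arguments ga_basis k {G} g.
Arguments ga_ext k {G} B x.

Definition alg_rota_baxter (k : fieldType) (A : algType k) (lambda : k)
    (P : {linear A -> A}) : Prop :=
  forall x y : A, P x * P y = P (P x * y + x * P y + lambda *: (x * y)).

Definition group_rota_baxter (G : groupType) (B : G -> G) : Prop :=
  forall g h : G, (B g * B h)%g = B (g * B g * h * (B g)^-1)%g.

Definition ga_rota_baxter_weight (k : fieldType) (G : groupType) (lambda : k)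
    (B : G -> G) : Prop :=
  group_rota_baxter B /\ alg_rota_baxter lambda (ga_ext k B).

Definition ga_rota_baxter (k : fieldType) (G : groupType) (B : G -> G) : Prop :=
  exists lambda : k, ga_rota_baxter_weight lambda B.

Arguments ga_rota_baxter k {G} B.

Section RotaBaxterBilinear.
Context (k : fieldType) (A : algType k) (lambda : k) (P : {linear A -> A}).

Definition rb_rhs (x y : A) : A := P (P x * y + x * P y + lambda *: (x * y)).

Lemma rb_rhs_linl (y : A) : linear (rb_rhs^~ y).
Proof.
move=> c a b; rewrite /rb_rhs -linearP; apply: (congr1 (P : A -> A)).
rewrite linearP !mulrDl -!scalerAl !scalerDr !scalerA [lambda * c]mulrC.
by rewrite (addrACA (c *: (P a * y))) [LHS]addrACA.
Qed.

Lemma rb_rhs_linr (x : A) : linear (rb_rhs x).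
Proof.
move=> c a b; rewrite /rb_rhs -linearP; apply: (congr1 (P : A -> A)).
rewrite linearP !mulrDr -!scalerAr !scalerDr !scalerA [lambda * c]mulrC.
by rewrite (addrACA (c *: (P x * a))) [LHS]addrACA.
Qed.

End RotaBaxterBilinear.

(* By bilinearity, the algebra identity may be tested on group elements.      *)
Lemma alg_rota_baxter_basisP (k : fieldType) (G : groupType) (lambda : k)
    (B : G -> G) :
  alg_rota_baxter lambda (ga_ext k B) <->
  forall g h : G,
    ga_basis k (B g) * ga_basis k (B h) =
    ga_ext k B (ga_basis k (B g) * ga_basis k h + ga_basis k g * ga_basis k (B h)
                + lambda *: (ga_basis k g * ga_basis k h)).
Proof.
pose L : {linear group_algebra k G -> group_algebra k G} := ga_ext k B.
have LU g : L (ga_basis k g) = ga_basis k (B g) by apply: ga_extU.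
rewrite -/L; split=> [RB g h|RB x y].
  by rewrite -[ga_basis k (B g)]LU -[ga_basis k (B h)]LU; apply: RB.
pose F u v := L u * L v; pose E := rb_rhs lambda L.
rewrite -[LHS]/(F x y) -[RHS]/(E x y).
apply: (@ga_ind k G (F^~ y) (E^~ y)).
- by move=> c a b; rewrite /F linearP mulrDl scalerAl.
- by move=> c a b; apply: rb_rhs_linl.
move=> g; apply: (@ga_ind k G (F (ga_basis k g)) (E (ga_basis k g))).
- by move=> c a b; rewrite /F linearP mulrDr scalerAr.
- by move=> c a b; apply: rb_rhs_linr.
by move=> h; rewrite /F /E /rb_rhs !LU; apply: RB.
Qed.

Local Open Scope classical_set_scope.

Definition exact_factorization (G : groupType) (K H : set G) : Prop :=
  [/\ group_closed [in K], group_closed [in H],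
      [set (x * y)%g | x in K & y in H] = [set: G] & K `&` H = [set 1%g]].

Definition projection_along (G : groupType) (K H : set G) (B : G -> G) : Prop :=
  {in K & H, forall x y, B (x * y)%g = y}.

Definition square_conj_stable (G : groupType) (K H : set G) : Prop :=
  {in H, forall y, [set (y ^+ 2 * x * y ^- 2)%g | x in K] `<=` K}.

(* Main.v *)
Require Import Defs.
From HB Require Import structures.
From mathcomp Require Import all_boot all_algebra.
From mathcomp Require Import monalg.
From mathcomp Require Import boolp classical_sets.

(** Evaluating the algebra identity at a pair [(g, 1)] gives
    [B (B g) = - lambda B g] in the group algebra, and comparing coefficients
    forces [B (B g) = B g]; this is the only consequence of the algebra identity
    that is needed.  For an idempotent group Rota-Baxter operator, the group
    identity alone gives the rest: [B] fixes [H] pointwise, so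
    [x y = B (x x y x^-1) = x x y x^-1] on [H] makes [H] commutative,
    [B (g (B g)^-1) = 1] yields the factorization, and evaluating at [y]
    and [x y^-1] with [x] in the kernel gives [B (y^2 x y^-2) = 1].
    Conversely, for the projection [B] along such a factorization,
    [B g * B h = B (g * B h)] and [B (B g * h) = B (g * h)], so the algebra
    identity holds with weight [-1]. *)

Set Implicit Arguments.
Unset Strict Implicit.
Unset Printing Implicit Defensive.

Local Open Scope classical_set_scope.
Local Open Scope group_scope.

(** The coefficient at [g] is 1 on the left, but 0 on the right if [g] and [h] differ. *)
Lemma ga_basis_scale_inj (k : fieldType) (G : groupType) (c : k) (g h : G) :
  ga_basis k g = (c *: ga_basis k h)%R -> g = h.
Proof.
move=> /(congr1 (mcoeff g)); rewrite mcoeffZ !mcoeffU eqxx.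
case: (eqVneq h g) => [//|_] /eqP.
by rewrite GRing.mulr0 GRing.oner_eq0.
Qed.

Section GroupRotaBaxter.
Context (G : groupType) (B : G -> G).
Hypothesis RB : group_rota_baxter B.

Lemma group_rb1 : B 1 = 1.
Proof. by apply: (@mulgI _ (B 1)); rewrite RB mul1g !mulg1 mulgV. Qed.

Lemma group_rb_rangeM (x y : G) : range B x -> range B y -> range B (x * y).
Proof. by case=> [u _ <-] [v _ <-]; rewrite RB; apply: imageT. Qed.

Lemma group_rb_rangeV (x : G) : range B x -> range B x^-1.
Proof.
(* The witness [v] solves [u * B u * v * (B u)^-1 = 1], so that [B u * B v = B 1]. *)
case=> [u _ <-]; exists ((B u)^-1 * u^-1 * B u) => //.
by apply: (@mulgI _ (B u)); rewrite RB mulgV !mulgA !mulgK mulgV group_rb1.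
Qed.

Lemma group_rb_kerMl (x y : G) : B x = 1 -> B (x * y) = B y.
Proof. by move=> Kx; rewrite -[RHS]mul1g -Kx RB Kx mulg1 invg1 mulg1. Qed.

Lemma group_rb_kerV (x : G) : B x = 1 -> B x^-1 = 1.
Proof. by move=> Kx; rewrite -(group_rb_kerMl _ Kx) mulgV group_rb1. Qed.

Lemma ga_rb_idem (k : fieldType) (lambda : k) :
  alg_rota_baxter lambda (ga_ext k B) -> idempotent_fun B.
Proof.
move=> /alg_rota_baxter_basisP aRB g /=.
have := aRB g 1; rewrite group_rb1 !ga_basisM !mulg1.
rewrite !(GRing.linearD, GRing.linearZ) /= !ga_extU => E.
(* [E] equates [B g] with [B (B g) + B g + lambda B g]; cancelling [B g] leaves a relation between
   two basis vectors. *)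
apply: (@ga_basis_scale_inj k _ (- lambda)%R).
rewrite GRing.scaleNr; apply/eqP; rewrite -GRing.addr_eq0; apply/eqP.
apply: (GRing.addrI (ga_basis k (B g))).
by rewrite GRing.addr0 [RHS]E GRing.addrA (GRing.addrC (ga_basis k (B g))).
Qed.

Hypothesis idemB : idempotent_fun B.

Lemma group_rb_fix (y : G) : range B y -> B y = y.
Proof. by case=> x _ <-; apply: idemB. Qed.

Lemma group_rb_commute (x y : G) : range B x -> range B y -> commute x y.
Proof.
(* As [B x = x], this is the argument of [B] in the identity at [(x, y)]; lying in the range, it is
   fixed by [B]. *)
move=> Hx Hy; have Hz : range B (x * x * y * x^-1).
  by do 3?[apply: group_rb_rangeM => //]; apply: group_rb_rangeV.
have := RB x y.
rewrite (group_rb_fix Hx) (group_rb_fix Hy) (group_rb_fix Hz) -!mulgA.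
by move/mulgI=> E; rewrite /commute {2}E !mulgA mulgVK.
Qed.

(** At the pair [(g, (B g)^-1)] the argument of [B] collapses to [g * (B g)^-1], while the product
    of values is 1 because [B] fixes [(B g)^-1]. *)
Lemma group_rb_ker_part (g : G) : B (g * (B g)^-1) = 1.
Proof.
have HV : range B (B g)^-1 by apply/group_rb_rangeV/imageT.
by have := RB g (B g)^-1; rewrite (group_rb_fix HV) mulgK mulgV => <-.
Qed.

Lemma group_rb_square_conj (x y : G) :
  B x = 1 -> range B y -> B (y ^+ 2 * x * y ^- 2) = 1.
Proof.
move=> Kx Hy; have HV := group_rb_rangeV Hy.
have := RB y (x * y^-1); rewrite group_rb_kerMl //.
rewrite (group_rb_fix Hy) (group_rb_fix HV) mulgV => ->.
by rewrite expg2 invgM !mulgA.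
Qed.

Lemma group_rb_factorization :
  exact_factorization [set g | B g = 1] (range B).
Proof.
split.
- split=> [|x y]; rewrite !inE /=; first exact: group_rb1.
  by move=> Kx Ky; rewrite group_rb_kerMl ?group_rb_kerV.
- split=> [|x y]; rewrite !inE; first by exists 1 => //; apply: group_rb1.
  by move=> Hx Hy; apply/group_rb_rangeM/group_rb_rangeV.
- apply/seteqP; split=> // g _; exists (g * (B g)^-1).
    exact: group_rb_ker_part.
  by exists (B g); [apply: imageT | rewrite mulgVK].
apply/seteqP; split=> g /=; first by case=> Kg /group_rb_fix; rewrite Kg.
by move=> ->; split; [|exists 1 => //]; apply: group_rb1.
Qed.

End GroupRotaBaxter.

Section ExactFactorization.
Context (G : groupType) (K H : set G).
Hypothesis exKH : exact_factorization K H.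

Let K1 : 1 \in K. Proof. by case: exKH => -[]. Qed.
Let KM : {in K &, forall x y, x * y \in K}.
Proof. by case: exKH => /group_closedM KM _ _ _; apply: KM. Qed.
Let HM : {in H &, forall x y, x * y \in H}.
Proof. by case: exKH => _ /group_closedM HM _ _; apply: HM. Qed.
Let HV : {in H, forall x, x^-1 \in H}.
Proof. by case: exKH => _ /group_closedV HV _ _; apply: HV. Qed.

Lemma exact_factorizationP (g : G) :
  exists2 x, x \in K & exists2 y, y \in H & g = x * y.
Proof.
case: exKH => _ _ KH _; have: [set: G] g by [].
by rewrite -KH => -[x /mem_set Kx [y /mem_set Hy <-]]; exists x => //; exists y.
Qed.

(** The element [x'^-1 * x = y' * y^-1] lies in both subgroups, hence is trivial. *)
Lemma exact_factorization_injr (x x' y y' : G) :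
  x \in K -> x' \in K -> y \in H -> y' \in H -> x * y = x' * y' -> y = y'.
Proof.
case: (exKH) => -[_ KD] [_ HD] _ KIH Kx Kx' Hy Hy' E.
have E' : x'^-1 * x = y' * y^-1.
  by apply: (@mulgI _ x'); apply: (@mulIg _ y); rewrite mulVKg E !mulgA mulgVK.
have: (K `&` H) (y' * y^-1).
  split; apply/set_mem; last exact: HD.
  rewrite -E'; apply: KM => //; exact: (group_closedV (conj K1 KD)).
by rewrite KIH => /divg1_eq.
Qed.

Lemma projection_along_exists : exists B : G -> G, projection_along K H B.
Proof.
have /choice[B BP] : forall g, exists y,
    y \in H /\ exists2 x, x \in K & g = x * y.
  move=> g; have [x Kx [y Hy ->]] := exact_factorizationP g.
  by exists y; split=> //; exists x.
exists B => x y Kx Hy; have [HB [x' Kx' E]] := BP (x * y).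
by have := exact_factorization_injr Kx Kx' Hy HB E.
Qed.

Lemma projection_along_unique (B B' : G -> G) :
  projection_along K H B -> projection_along K H B' -> B = B'.
Proof.
move=> PB PB'; apply/funext => g.
have [x Kx [y Hy ->]] := exact_factorizationP g.
by rewrite PB ?PB'.
Qed.

Hypothesis commH : {in H &, forall x y, commute x y}.
Hypothesis sqK : square_conj_stable K H.
Variable B : G -> G.
Hypothesis PB : projection_along K H B.

Lemma projection_along_rb : group_rota_baxter B.
Proof.
move=> g h; have [x Kx [y Hy ->]] := exact_factorizationP g.
have [x' Kx' [y' Hy' ->]] := exact_factorizationP h.
rewrite (PB Kx Hy) (PB Kx' Hy').
have Kc : y ^+ 2 * x' * y ^- 2 \in K.
  by apply/mem_set/(sqK Hy); exists x' => //; apply/set_mem.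
(* Commutativity of [H] splits the argument into a factor in [K] and the factor [y * y'] in [H],
   which [B] returns. *)
have -> : x * y * y * (x' * y') * y^-1 = x * (y ^+ 2 * x' * y ^- 2) * (y * y').
  have E : y ^- 2 * (y * y') = y' * y^-1.
    by rewrite (commH Hy' (HV Hy)) expg2 invgM mulgA mulgVK.
  by rewrite -[RHS]mulgA -[in RHS](mulgA _ (y ^- 2)) E expg2 !mulgA.
by rewrite PB; [| exact: KM | exact: HM].
Qed.

Lemma projection_along_alg_rb (k : fieldType) :
  alg_rota_baxter (-1)%R (ga_ext k B).
Proof.
apply/alg_rota_baxter_basisP => g h.
have [x Kx [y Hy ->]] := exact_factorizationP g.
have [x' Kx' [y' Hy' ->]] := exact_factorizationP h.
have Kl z : B (x * z) = B z.
  have [u Ku [v Hv ->]] := exact_factorizationP z.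
  by rewrite mulgA !PB ?KM.
rewrite (PB Kx Hy) (PB Kx' Hy') !ga_basisM.
rewrite !(GRing.linearD, GRing.linearZ) /= !ga_extU.
have Byy' : B (y * y') = y * y' by rewrite -[in LHS](mul1g (y * y')) PB ?HM.
(* Dropping left factors from [K] turns the three terms into [B (y * (x' * y'))], [y * y'] and
   [- B (y * (x' * y'))]; weight -1 makes the outer two cancel. *)
rewrite -!mulgA !Kl Byy'.
by rewrite GRing.scaleN1r GRing.addrC GRing.addrA GRing.addNr GRing.add0r.
Qed.

End ExactFactorization.

Theorem theorem3p3 (k : fieldType) (G : groupType) :
  (forall B : G -> G, ga_rota_baxter k B ->
     let H := range B in
     let K := [set g | B g = 1%g] in
     [/\ exact_factorization K H,
         projection_along K H B,
         {in H &, forall x y, commute x y} &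
         square_conj_stable K H])
  /\
  (forall K H : set G,
     exact_factorization K H ->
     {in H &, forall x y, commute x y} ->
     square_conj_stable K H ->
     (exists! B : G -> G, projection_along K H B) /\
     (forall B : G -> G, projection_along K H B -> ga_rota_baxter k B)).
Proof.
split=> [B [lambda [RB /(ga_rb_idem RB) idemB]] H K|K H exKH commH sqK].
  split.
  - exact: group_rb_factorization.
  - move=> x y /set_mem Kx /set_mem Hy.
    by rewrite group_rb_kerMl // group_rb_fix.
  - by move=> x y /set_mem Hx /set_mem Hy; apply: group_rb_commute.
  - by move=> y /set_mem Hy _ [x Kx <-]; apply: group_rb_square_conj.
split.
  have [B PB] := projection_along_exists exKH.
  by exists B; split=> // B'; apply: projection_along_unique.
move=> B PB; exists (-1)%R; split; first exact: projection_along_rb PB.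
exact: projection_along_alg_rb PB k.
Qed.
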